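(* Consider the full access pattern in the proactive system, with the cache-bandwidth allocation problem $$\min_{\mathbf b,\mathbf l}\ \sum_{i=1}^{M}p_i\frac{L-e^{\frac{f_B}{r}b_i}l_i}{r\left(e^{\frac{f_B}{r}b_i}-1\right)}\quad\text{s.t.}\quad \sum_{i=1}^M b_i\le B,\ \ \sum_{i=1}^M l_i\le C,\ \ b_i\ge0,\ \ 0\le l_i\le Le^{-\frac{f_B}{r}b_i}\ \ (i=1,\dots,M),$$ where $\mathbf b=[b_1,\dots,b_M]$ and $\mathbf l=[l_1,\dots,l_M]$. This problem of $2M$ variables can be simplified to a one-dimensional search of the first cache size $l_1$: $$(\mathbf l^*,\mathbf b^* )=\arg\min_{l_1}\ \phi(l_1),$$ where $l_1\in[L/M,\ \min(L,C)]$ and $\phi(l_1)$ is the average waiting time (the objective above) in terms of $l_1$ when the cache allocation is $$l_i=\begin{cases}l_1,&1\le i\le k-1,\\ C\bmod l_1,& i=k,\\ 0,&k+1\le i\le M,\end{cases}$$ in which $k=\lfloor C/l_1\rfloor+1$ is the threshold video number which has cache storage allocated, and the bandwidth allocation is as follows. If $l_1<C$, the bandwidth allocation is $$b_i=\begin{cases}\frac{r}{f_B}\ln\frac{L}{l_1},&1\le i\le k-1,\\[4pt] \frac{r}{f_B}\ln\left(\frac{2+p_i\beta(L-l_i)+\sqrt{(p_i\beta(L-l_i))^2+4p_i\beta(L-l_i)}}{2}\right),&k\le i\le M,\end{cases}$$ where $\beta$ meets the bandwidth constraint $\sum_{i=1}^M b_i=B$. If $l_1=C\le L$, the cache capacity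 is allocated to the first video and, for $i=1,2,\dots,M$, $$b_i=\frac{r}{f_B}\ln\left(\frac{2+p_i\beta(L-l_i)+\sqrt{(p_i\beta(L-l_i))^2+4p_i\beta(L-l_i)}}{2}\right),$$ where $\beta$ again meets the bandwidth constraint $\sum_{i=1}^M b_i=B$.
   Context: There are $M$ videos of equal length $L$ and equal bitrate $r$, with popularities (access probabilities) $p_1\ge p_2\ge\dots\ge p_M$, $\sum_{i=1}^M p_i=1$. Every client has cache size $C<ML$; $B$ is the total bandwidth and $f_B$ the bandwidth efficiency (bps/Hz). In the proactive system, videos are broadcast periodically and clients cannot report their demands; $b_i$ is the bandwidth allocated for periodically broadcasting video $i$, and $l_i$ is the client cache size allocated to storing video $i$. Under the full access pattern, clients watch the desired video from beginning to end. The fraction in the $i$-th summand of the objective is the waiting time for video $i$ with bandwidth $b_i$ and cache size $l_i$ under the optimal proactive delivery mechanism, so the objective is the average client waiting time. $C\bmod l_1$ denotes $C-l_1\lfloor C/l_1\rfloor$.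
   Formalization: The search for l_1 starts at min(L,C)/M instead of L/M; at l_1=C≤L the first bandwidth formula is allowed besides the second; only allocations meeting the problem's constraints are searched; Σb_i=B is required only if some b_i depends on β. *)

(* Defs.v *)
(* MathComp-Analysis. *)
From HB Require Import structures.
From mathcomp Require Import all_boot all_order all_algebra.
From mathcomp Require Import all_classical all_reals all_analysis.
Set Implicit Arguments.
Unset Strict Implicit.
Unset Printing Implicit Defensive.
Import Order.TTheory GRing.Theory Num.Theory.
Local Open Scope classical_set_scope.
Local Open Scope ring_scope.

(* L : length, r : bitrate, fB : bandwidth efficiency, B : total bandwidth,
   C : client cache size, p i : popularity.  Videos are numbered from 0, so
   [i : 'I_M] is the video usually numbered i + 1. *)

(* The quotient is taken in the extended reals, where 0^-1 = +oo and
   0 * +oo = 0: a video without bandwidth has infinite waiting time, unless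
   it is entirely cached (l = L), and then the waiting time is 0. *)
Definition waiting_time (R : realType) (L r fB b l : R) : \bar R :=
  let e := expR (fB / r * b) in
  ((L - e * l)%:E / (r * (e - 1))%:E)%E.

Definition avg_waiting_time (R : realType) (M : nat) (L r fB : R)
    (p b l : 'I_M -> R) : \bar R :=
  (\sum_(i < M) (p i)%:E * waiting_time L r fB (b i) (l i))%E.

Definition feasible (R : realType) (M : nat) (L r fB B C : R)
    (b l : 'I_M -> R) : Prop :=
  [/\ \sum_(i < M) b i <= B,
      \sum_(i < M) l i <= C,
      (forall i, 0 <= b i) &
      (forall i, 0 <= l i <= L * expR (- (fB / r * b i)))].

Definition optimal_allocation (R : realType) (M : nat) (L r fB B C : R)
    (p b l : 'I_M -> R) : Prop :=
  feasible L r fB B C b l /\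
  forall b' l' : 'I_M -> R, feasible L r fB B C b' l' ->
    (avg_waiting_time L r fB p b l <= avg_waiting_time L r fB p b' l')%E.

(* [full_videos C l1] is k - 1, where k is the threshold video number. *)
Definition full_videos (R : realType) (C l1 : R) : nat := Num.truncn (C / l1).

Definition cache_allocation (R : realType) (M : nat) (C l1 : R) (i : 'I_M) : R :=
  if (i < full_videos C l1)%N then l1
  else if i == full_videos C l1 :> nat then C - l1 * (full_videos C l1)%:R
  else 0.

Definition multiplier_bandwidth (R : realType) (L r fB beta pi li : R) : R :=
  let c := pi * beta * (L - li) in
  r / fB * ln ((2 + c + Num.sqrt (c ^+ 2 + 4 * c)) / 2).

(* The first [n] videos get just enough bandwidth to have waiting time 0 with
   cache size l1; the others get the bandwidth given by beta. *)
Definition bandwidth_allocation (R : realType) (M n : nat) (L r fB C : R)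
    (p : 'I_M -> R) (l1 beta : R) (i : 'I_M) : R :=
  if (i < n)%N then r / fB * ln (L / l1)
  else multiplier_bandwidth L r fB beta (p i) (cache_allocation C l1 i).

(* The numbers of videos to which the waiting-time-0 bandwidth may be given:
   k - 1, or none if the whole cache goes to the first video.  For l1 = C both
   are allowed: when the first video is much more popular than the others, the
   bandwidth given by beta would exceed the maximum r / fB * ln (L / C). *)
Definition saturated_number (R : realType) (L C l1 : R) (n : nat) : Prop :=
  (l1 <= C /\ n = full_videos C l1) \/ (l1 = C /\ C <= L /\ n = 0%N).

(* [b] is a bandwidth allocation associated with l1.  The multiplier beta has
   to exhaust the bandwidth as soon as some video depends on it; if none does
   (for instance when all the videos have waiting time 0), there is no beta to
   be determined, and only the inequality contained in [feasible] remains. *)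
Definition induced_bandwidth (R : realType) (M : nat) (L r fB B C : R)
    (p : 'I_M -> R) (l1 : R) (b : 'I_M -> R) : Prop :=
  exists (n : nat) (beta : R),
    [/\ saturated_number L C l1 n,
        0 <= beta,
        b = bandwidth_allocation n L r fB C p l1 beta,
        ((exists2 i : 'I_M, (n <= i)%N & 0 < p i * (L - cache_allocation C l1 i)) ->
          \sum_(i < M) b i = B) &
        feasible L r fB B C b (cache_allocation C l1)].

(* +oo if no bandwidth allocation is associated with l1. *)
Definition phi (R : realType) (M : nat) (L r fB B C : R) (p : 'I_M -> R)
    (l1 : R) : \bar R :=
  ereal_inf [set avg_waiting_time L r fB p b (cache_allocation C l1) |
             b in induced_bandwidth L r fB B C p l1].

(* For L <= C the lower end is L / M; for C < L it is C / M, since an optimal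
   l1 may then be smaller than L / M. *)
Definition search_interval (R : realType) (M : nat) (L C : R) : set R :=
  [set l1 | Num.min L C / M%:R <= l1 <= Num.min L C].

Definition minimizers (R : realType) (T : Type) (D : set T) (f : T -> \bar R) : set T :=
  [set x | D x /\ forall y, D y -> (f x <= f y)%E].

(* Main.v *)
Require Import Defs.
From mathcomp Require Import all_boot all_order all_algebra.
From mathcomp Require Import all_fingroup.
From mathcomp Require Import all_classical all_reals all_analysis.
From mathcomp Require Import ring lra.
Import Order.TTheory GRing.Theory Num.Theory.
Import numFieldNormedType.Exports.
Local Open Scope classical_set_scope.
Local Open Scope ring_scope.
Set Implicit Arguments.
Unset Strict Implicit.
Unset Printing Implicit Defensive.

(** Put [x i = exp (fB * b i / r)] and [s i = r * (waiting time of video i)].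
    The problem becomes: minimise [\sum p i * s i] subject to
    [\prod x i <= exp (fB * B / r)], [\sum l i <= C] and
    [L + s i <= x i * (l i + s i)]; a minimum exists by compactness.  Suppose
    that it is positive.  Then the bandwidth and the cache are both exhausted.
    Since video i uses the bandwidth [ln ((L + s i) / (l i + s i))], the cache
    fills up the sums [l i + s i] to a common water level.  Two videos with
    [0 < l i] and [0 < s i] cannot coexist, by concavity, so that, after sorting
    by [s], the first videos have [s i = 0] and the same [l i], at most one video
    comes next with the rest of the cache, and the others have [l i = 0].
    Stationarity among the videos with [0 < s i] gives the multiplier beta.  If
    the minimum is 0, the inequality of arithmetic and geometric means shows that
    the cache may be shared equally among the videos with [0 < p i]. *)

(** * Existence of an optimum of the relaxed problem, by compactness *)

Section Relaxation.
Variables (R : realType) (M : nat) (L E C : R) (p : 'I_M -> R).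
Hypotheses (L_gt0 : 0 < L) (E_gt1 : 1 < E) (C_gt0 : 0 < C).
Hypotheses (p_ge0 : forall i, 0 <= p i) (p_sum1 : \sum_i p i = 1).
Implicit Types x l s : 'I_M -> R.

Definition cost s : R := \sum_i p i * s i.

(* The last condition says that the waiting time is at most [s i / r]; it is void
   for [p i = 0], where the waiting time may be infinite. *)
Definition relaxed_feasible x l s : Prop :=
  [/\ \prod_i x i <= E, \sum_i l i <= C,
      forall i, [/\ 1 <= x i, 0 <= l i, l i <= L & 0 <= s i] &
      forall i, 0 < p i -> L + s i <= x i * (l i + s i)].

Definition relaxed_optimal x l s : Prop :=
  relaxed_feasible x l s /\
  forall x' l' s', relaxed_feasible x' l' s' -> cost s <= cost s'.

Lemma cost_ge0 s : (forall i, 0 <= s i) -> 0 <= cost s.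
Proof. by move=> s0; apply: sumr_ge0 => i _; rewrite mulr_ge0. Qed.

Lemma ler_prod_ge1 x i : (forall j, 1 <= x j) -> x i <= \prod_j x j.
Proof.
move=> x1; rewrite (bigD1 i)//= ler_peMr//; first exact: le_trans (x1 i).
by elim/big_ind: _ => // a b a1 b1; rewrite mulr_ege1.
Qed.

Lemma index_bound_gt0 : (0 < M)%N.
Proof.
case: M p p_sum1 => // q; rewrite big_ord0 => /eqP.
by rewrite eq_sym oner_eq0.
Qed.

Let coordx (i : 'I_M) (v : 'rV[R]_M * 'rV[R]_M * 'rV[R]_M) : R := v.1.1 ord0 i.
Let coordl (i : 'I_M) (v : 'rV[R]_M * 'rV[R]_M * 'rV[R]_M) : R := v.1.2 ord0 i.
Let coords (i : 'I_M) (v : 'rV[R]_M * 'rV[R]_M * 'rV[R]_M) : R := v.2 ord0 i.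

Let coordx_cont i : continuous (coordx i).
Proof.
move=> v; apply: (@cvg_comp _ _ _ (fun w => w.1.1) (fun m : 'rV[R]_M => m ord0 i)).
  by apply: (@cvg_comp _ _ _ fst fst); [exact: cvg_fst|exact: cvg_fst].
exact: coord_continuous.
Qed.

Let coordl_cont i : continuous (coordl i).
Proof.
move=> v; apply: (@cvg_comp _ _ _ (fun w => w.1.2) (fun m : 'rV[R]_M => m ord0 i)).
  by apply: (@cvg_comp _ _ _ fst snd); [exact: cvg_fst|exact: cvg_snd].
exact: coord_continuous.
Qed.

Let coords_cont i : continuous (coords i).
Proof.
move=> v; apply: (@cvg_comp _ _ _ snd (fun m : 'rV[R]_M => m ord0 i)).
  exact: cvg_snd.
exact: coord_continuous.
Qed.

Lemma continuous_sum_ord (T : topologicalType) (f : 'I_M -> T -> R) :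
  (forall i, continuous (f i)) -> continuous (fun v => \sum_i f i v).
Proof. by move=> fc; apply: continuous_big => //; exact: add_continuous. Qed.

Lemma continuous_prod_ord (T : topologicalType) (f : 'I_M -> T -> R) :
  (forall i, continuous (f i)) -> continuous (fun v => \prod_i f i v).
Proof. by move=> fc; apply: continuous_big => //; exact: mul_continuous. Qed.

Lemma closed_le_fun (T : topologicalType) (f g : T -> R) :
  continuous f -> continuous g -> closed [set v | f v <= g v].
Proof.
move=> fc gc.
rewrite (_ : [set _ | _] = (g \- f) @^-1` [set y | 0 <= y]); last first.
  by apply/seteqP; split => v /=; rewrite subr_ge0.
apply: preimage_closed; last exact: closed_ge.
by move=> v _; apply: continuousB; [exact: gc|exact: fc].
Qed.

(** The bandwidth is split equally, so that [x0 ^+ M = E], nothing is cached, and [s0] solves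
    [L + s0 = x0 * s0]. The value [s0] then bounds the region to search for an optimum. *)
Lemma relaxed_feasible_constant : exists2 s0 : R, 0 < s0 &
  exists x0 : R, relaxed_feasible (fun=> x0) (fun=> 0) (fun=> s0).
Proof.
have M0 := index_bound_gt0.
pose x0 := expR (ln E / M%:R).
have x01 : 1 < x0 by rewrite expR_gt1 divr_gt0 ?ln_gt0// ltr0n.
exists (L / (x0 - 1)); first by rewrite divr_gt0// subr_gt0.
exists x0; split.
- rewrite prodr_const card_ord -expRM_natl -mulr_natl mulrCA divff ?mulr1.
    by rewrite lnK// posrE (lt_trans ltr01).
  by rewrite pnatr_eq0 -lt0n.
- by rewrite big1// ltW.
- by move=> i; rewrite (ltW x01) lexx (ltW L_gt0) divr_ge0// ?subr_ge0 ltW.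
- move=> i _; rewrite add0r -lerBrDr -{2}[L / _]mul1r -mulrBl.
  by rewrite mulrC divfK// subr_eq0 gt_eqF.
Qed.

Lemma relaxed_optimal_exists : exists x l s, relaxed_optimal x l s.
Proof.
have [s0 s0_gt0 [x0 rf0]] := relaxed_feasible_constant.
have cost0 : cost (fun=> s0) = s0 by rewrite /cost -mulr_suml p_sum1 mul1r.
(* A triple of cost below [s0] has [p i * s i <= s0], hence the first summand; the second makes room
   for the constant triple. For [p i = 0] the quotient is 0 and [T i = s0]. *)
pose T i := s0 / p i + s0.
pose box : set ('rV[R]_M * 'rV[R]_M * 'rV[R]_M) :=
  ([set v : 'rV[R]_M | forall i, `[1, E]%classic (v ord0 i)] `*`
   [set v : 'rV[R]_M | forall i, `[0, L]%classic (v ord0 i)]) `*`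
   [set v : 'rV[R]_M | forall i, `[0, T i]%classic (v ord0 i)].
pose K := box `&` ([set v | \prod_i coordx i v <= E] `&`
   ([set v | \sum_i coordl i v <= C] `&`
   \bigcap_(i in [set i | 0 < p i])
     [set v | L + coords i v <= coordx i v * (coordl i v + coords i v)])).
have cK : compact K.
  apply: compact_closedI.
    apply: compact_setX; first apply: compact_setX.
    - by apply: (@rV_compact R M (fun=> `[1, E]%classic)) => i;
        exact: segment_compact.
    - by apply: (@rV_compact R M (fun=> `[0, L]%classic)) => i;
        exact: segment_compact.
    - by apply: (@rV_compact R M (fun i => `[0, T i]%classic)) => i;
        exact: segment_compact.
  apply: closedI.
    apply: (@preimage_closed _ _ (fun v => \prod_i coordx i v) [set y | y <= E]) => [v _|].
      exact: continuous_prod_ord.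
    exact: closed_le.
  apply: closedI.
    apply: (@preimage_closed _ _ (fun v => \sum_i coordl i v) [set y | y <= C]) => [v _|].
      exact: continuous_sum_ord.
    exact: closed_le.
  apply: closed_bigI => i _; apply: closed_le_fun => v.
    by apply: cvgD; [exact: cvg_cst|exact: coords_cont].
  apply: cvgM; first exact: coordx_cont.
  by apply: cvgD; [exact: coordl_cont|exact: coords_cont].
have inK x l s : relaxed_feasible x l s -> (forall i, s i <= T i) ->
    K (\row_i x i, \row_i l i, \row_i s i).
  move=> [x1 l1 b f] sT; split.
    split; [split|] => i /=; rewrite !mxE in_itv/=.
    - by case: (b i) => ->*; rewrite (le_trans _ x1)//;
        apply: ler_prod_ge1 => j; case: (b j).
    - by case: (b i) => _ -> ->.
    - by case: (b i) => _ _ _ ->; rewrite sT.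
  split; first by rewrite /= /coordx/=; under eq_bigr do rewrite mxE.
  split; first by rewrite /= /coordl/=; under eq_bigr do rewrite mxE.
  by move=> i pi; rewrite /= /coordx /coordl /coords /= !mxE; exact: f.
have [||[[vx vl] vs] /set_mem Kc cmin] :=
    @compact_EVT_min _ R (fun v => \sum_i p i * coords i v) K _ cK.
- exists (\row_i x0, \row_i 0, \row_i s0); apply: (inK _ _ _ rf0) => i.
  by rewrite lerDr divr_ge0// ltW.
- apply: continuous_subspaceT => v; apply: continuous_sum_ord => i w.
  by apply: cvgM; [exact: cvg_cst|exact: coords_cont].
exists (vx ord0), (vl ord0), (vs ord0).
have cmin' x l s : relaxed_feasible x l s -> (forall i, s i <= T i) ->
    cost (vs ord0) <= cost s.
  move=> rf sT; have := cmin _ (mem_set (inK _ _ _ rf sT)).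
  by rewrite /coords/=; under [leRHS]eq_bigr do rewrite mxE.
split.
  case: Kc => -[[bx bl] bs] [/= fx [/= fl fs]]; split => // i.
  move: (bx i) (bl i) (bs i); rewrite /= !in_itv/=.
  by move=> /andP[-> _] /andP[-> ->] /andP[-> _].
move=> x l s rf.
have [s0s|ss0] := leP s0 (cost s).
  apply: le_trans s0s; rewrite -cost0; apply: cmin' rf0 _ => i.
  by rewrite lerDr divr_ge0// ltW.
(* The coordinates [s i] with [p i = 0] are unbounded. They count neither in the cost nor in the
   constraints other than [0 <= s i], so resetting them to 0 brings the triple into the box. *)
pose s' i := if 0 < p i then s i else 0.
have -> : cost s = cost s'.
  apply: eq_bigr => i _; rewrite /s'; case: ltP => // pi.
  by have /eqP-> : p i == 0; rewrite ?mul0r// eq_le pi p_ge0.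
case: rf => x1 l1 b f.
apply: (cmin' x l).
  split => // i; last by move=> pi; rewrite /s' pi; exact: f.
  by case: (b i) => *; split => //; rewrite /s'; case: ifP.
move=> i; rewrite /s' /T; case: ltP => pi; last by rewrite addr_ge0 ?divr_ge0 // ltW.
apply: ler_wpDr; first exact: ltW.
rewrite ler_pdivlMr// mulrC; apply: le_trans (ltW ss0).
rewrite /cost (bigD1 i)//= lerDl sumr_ge0// => j _.
by rewrite mulr_ge0//; case: (b j).
Qed.

End Relaxation.

(** * Changing a single coordinate *)

Section Update.
Variables (R : realType) (M : nat).
Implicit Types (f : 'I_M -> R) (i : 'I_M) (a : R).

Definition update i a f k : R := if k == i then a else f k.

Lemma update_eq i a f : update i a f i = a.
Proof. by rewrite /update eqxx. Qed.

Lemma update_neq i j a f : j != i -> update i a f j = f j.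
Proof. by rewrite /update => /negPf->. Qed.

Lemma sum_update i a f : \sum_k update i a f k = \sum_k f k - f i + a.
Proof.
rewrite (bigD1 i)//= [X in _ = X - _ + _](bigD1 i)//= update_eq.
rewrite (eq_bigr f); first by lra.
by move=> k ki; rewrite update_neq.
Qed.

Lemma prod_update i a f : f i * \prod_k update i a f k = a * \prod_k f k.
Proof.
rewrite (bigD1 i)//= [X in _ = _ * X](bigD1 i)//= update_eq.
rewrite (eq_bigr f); first by ring.
by move=> k ki; rewrite update_neq.
Qed.

Lemma cost_update (p : 'I_M -> R) i a f :
  cost p (update i a f) = cost p f - p i * f i + p i * a.
Proof.
rewrite /cost -(sum_update i (p i * a) (fun k => p k * f k)).
by apply: eq_bigr => k _; rewrite /update; case: eqP => // ->.
Qed.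

End Update.

(** * Exchange arguments at an optimum *)

Section Optimality.
Variables (R : realType) (M : nat) (L E C : R) (p : 'I_M -> R).
Hypothesis L_gt0 : 0 < L.
Hypothesis p_ge0 : forall i, 0 <= p i.

Notation feas := (relaxed_feasible L E C p).
Notation opt := (relaxed_optimal L E C p).

(** The constraints that concern one video only: after a change of one video, only its own instance
    has to be rechecked. *)
Definition admissible (i : 'I_M) (x l s : R) : Prop :=
  [/\ 1 <= x, 0 <= l, l <= L & 0 <= s] /\ (0 < p i -> L + s <= x * (l + s)).

Lemma relaxed_feasibleP x l s : feas x l s <->
  [/\ \prod_i x i <= E, \sum_i l i <= C &
      forall i, admissible i (x i) (l i) (s i)].
Proof.
split=> [[? ? b f]|[? ? b]]; split => // i.
- by split; [exact: b|exact: f].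
- by have [] := b i.
- by have [] := b i.
Qed.

Lemma admissible_update x l s i a b c :
  (forall k, admissible k (x k) (l k) (s k)) -> admissible i a b c ->
  forall k, admissible k (update i a x k) (update i b l k) (update i c s k).
Proof. by move=> adm admi k; rewrite /update; case: eqP => // ->. Qed.

Lemma feasible_prod_gt0 x l s : feas x l s -> 0 < \prod_i x i.
Proof.
case=> _ _ b _; apply: prodr_gt0 => i _.
by have [/(lt_le_trans ltr01)] := b i.
Qed.

Lemma optimal_of_le x l s x' l' s' :
  opt x l s -> feas x' l' s' -> cost p s' <= cost p s -> opt x' l' s'.
Proof.
by move=> [_ m] f le; split=> // x2 l2 s2 /m; exact: le_trans.
Qed.

Lemma cost_gt0_witness s : 0 < cost p s -> exists i, 0 < p i * s i.
Proof.
move=> c0; apply: contrapT => /forallNP n0.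
suff : cost p s <= 0 by rewrite leNgt c0.
by apply: sumr_le0 => i _; rewrite leNgt; apply/negP/n0.
Qed.

(** Spare bandwidth could be given to a video with [0 < p i * s i]; its constraint would become
    strict and [s i] could decrease. *)
Lemma optimal_bandwidth_tight x l s : opt x l s -> 0 < cost p s ->
  \prod_i x i = E.
Proof.
move=> [fxls m] c0; have [i pis0] := cost_gt0_witness c0.
have P0 := feasible_prod_gt0 fxls.
move: (fxls) => /relaxed_feasibleP [xE lC adm].
have [[x1 l0 lL s0] c] := adm i.
have pi0 : 0 < p i.
  by rewrite lt0r p_ge0 andbT; apply: contraTneq pis0 => ->; rewrite mul0r ltxx.
have si0 : 0 < s i by rewrite -(pmulr_rgt0 _ pi0).
apply/eqP; rewrite eq_le xE leNgt; apply/negP => ltE.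
pose a := x i * (E / \prod_i x i).
have xi_gt0 : 0 < x i by lra.
have xia : x i < a by rewrite /a ltr_pMr// ltr_pdivlMr// mul1r.
(* The second bound gives [L + s i <= a * (l i + s i - d)], which is more than the constraint for
   [s i - d] asks. *)
pose d := Num.min (s i) ((a * (l i + s i) - (L + s i)) / a).
have a0 : 0 < a by lra.
have d0 : 0 < d.
  rewrite /d lt_min si0 divr_gt0// subr_gt0; apply: le_lt_trans (c pi0) _.
  by rewrite ltr_pM2r//; lra.
have dle : d <= (a * (l i + s i) - (L + s i)) / a by rewrite ge_min lexx orbT.
have ds : d <= s i by rewrite ge_min lexx.
have : feas (update i a x) l (update i (s i - d) s).
  have lE : l = update i (l i) l.
    by apply/funext => k; rewrite /update; case: eqP => // ->.
  rewrite [l in feas _ l]lE; apply/relaxed_feasibleP; split; rewrite -?lE//.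
    rewrite -(ler_pM2l xi_gt0) prod_update /a -mulrA divfK ?lexx//.
    by rewrite gt_eqF.
  rewrite lE; apply: admissible_update => //; split; first by split => //; lra.
  move=> _; move: dle; rewrite ler_pdivlMr// => dle.
  by nra.
move=> /m; rewrite cost_update leNgt => /negP; apply.
by rewrite mulrBr; have := mulr_gt0 pi0 d0; lra.
Qed.

(** An entirely cached video satisfies its constraint with [s i = 0], at a smaller cost. *)
Lemma optimal_cache_lt x l s i : opt x l s -> 0 < p i -> 0 < s i -> l i < L.
Proof.
move=> [fxls m] pi0 si0; rewrite ltNge; apply/negP => Ll.
move: (fxls) => /relaxed_feasibleP [xE lC adm].
have [[x1 l0 lL s0] c] := adm i.
have : feas x l (update i 0 s).
  apply/relaxed_feasibleP; split => // k; rewrite /update; case: eqP => // ->.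
  by split => // _; rewrite !addr0; nra.
move=> /m; rewrite cost_update leNgt => /negP; apply.
by have := mulr_gt0 pi0 si0; lra.
Qed.

Lemma optimal_prod_update x l s i a b c : opt x l s -> 0 < cost p s ->
  admissible i a b c -> \sum_k update i b l k <= C -> p i * c <= p i * s i ->
  x i <= a.
Proof.
move=> o c0 admi lC cs; rewrite leNgt; apply/negP => ax.
have /relaxed_feasibleP [xE _ adm] := o.1.
have xi_gt0 : 0 < x i by case: (adm i) => -[]; lra.
have P0 := feasible_prod_gt0 o.1.
have PE := optimal_bandwidth_tight o c0.
have lt : \prod_k update i a x k < E.
  by rewrite -(ltr_pM2l xi_gt0) prod_update -PE ltr_pM2r.
have f : feas (update i a x) (update i b l) (update i c s).
  by apply/relaxed_feasibleP; split; [exact: ltW| |exact: admissible_update].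
have cle : cost p (update i c s) <= cost p s by rewrite cost_update; lra.
have o' := optimal_of_le o f cle.
have c0' : 0 < cost p (update i c s).
  by apply: lt_le_trans c0 _; exact: o.2 f.
by move: lt; rewrite (optimal_bandwidth_tight o' c0') ltxx.
Qed.

Lemma update_id (f : 'I_M -> R) i : update i (f i) f = f.
Proof. by apply/funext => k; rewrite /update; case: eqP => // ->. Qed.

(** Spare cache given to a video with [0 < p i * s i] would reduce the bandwidth that it needs for
    the same [s i]. *)
Lemma optimal_cache_tight x l s : opt x l s -> 0 < cost p s -> \sum_i l i = C.
Proof.
move=> o c0; have [i pis0] := cost_gt0_witness c0.
have /relaxed_feasibleP [xE lC adm] := o.1.
have [[x1 l0 lL s0] c] := adm i.
have pi0 : 0 < p i.
  by rewrite lt0r p_ge0 andbT; apply: contraTneq pis0 => ->; rewrite mul0r ltxx.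
have si0 : 0 < s i by rewrite -(pmulr_rgt0 _ pi0).
have llt := optimal_cache_lt o pi0 si0.
apply/eqP; rewrite eq_le lC leNgt; apply/negP => ltC.
pose e := Num.min (C - \sum_i l i) (L - l i).
have e0 : 0 < e by rewrite lt_min; lra.
have eC : e <= C - \sum_i l i by rewrite ge_min lexx.
have eL : e <= L - l i by rewrite ge_min lexx orbT.
suff : x i <= (L + s i) / (l i + e + s i).
  rewrite ler_pdivlMr; last by lra.
  by have := c pi0; nra.
apply: (optimal_prod_update o c0 (b := l i + e) (c := s i)) => //.
- split; first by split; rewrite ?ler_pdivlMr//; lra.
  by move=> _; rewrite divfK// gt_eqF//; lra.
- by rewrite sum_update; lra.
Qed.

(** Otherwise [x i] could be lowered to [(L + s i) / (l i + s i)], which is at least 1 because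
    [l i <= L]. *)
Lemma optimal_eq x l s i : opt x l s -> 0 < cost p s -> 0 < p i ->
  0 < l i + s i /\ x i * (l i + s i) = L + s i.
Proof.
move=> o c0 pi0.
have /relaxed_feasibleP [xE lC adm] := o.1.
have [[x1 l0 lL s0] c] := adm i.
have u0 : 0 < l i + s i.
  rewrite lt0r addr_ge0// andbT; apply/eqP => u0.
  by have := c pi0; rewrite u0 mulr0 leNgt ltr_wpDr.
split => //; apply/eqP; rewrite eq_le (c pi0) andbT -ler_pdivlMr//.
apply: (optimal_prod_update o c0 (b := l i) (c := s i)) => //.
- split; first by split; rewrite ?ler_pdivlMr//; lra.
  by move=> _; rewrite divfK// gt_eqF//; lra.
- by rewrite update_id.
Qed.

(** Bandwidth or cache held by such a video could be released at no cost, and then one of the two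
    resources would not be exhausted. *)
Lemma optimal_unpopular x l s i : opt x l s -> 0 < cost p s -> p i = 0 ->
  x i = 1 /\ l i = 0.
Proof.
move=> o c0 pi0.
have /relaxed_feasibleP [xE lC adm] := o.1.
have [[x1 l0 lL s0] c] := adm i.
split.
  apply/eqP; rewrite eq_le x1 andbT.
  apply: (optimal_prod_update o c0 (b := l i) (c := s i)) => //.
    by split; [split|rewrite pi0 ltxx].
  by rewrite update_id.
apply/eqP; rewrite eq_le l0 andbT.
have f : feas x (update i 0 l) s.
  apply/relaxed_feasibleP; split => //; first by rewrite sum_update; lra.
  move=> k; rewrite /update; case: eqP => // ->.
  by split; [split; rewrite // ltW|rewrite pi0 ltxx].
have := optimal_cache_tight (optimal_of_le o f (lexx _)) c0.
by rewrite sum_update (optimal_cache_tight o c0); lra.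
Qed.

(* As [x k = (L + s k) / (l k + s k)], this is [x i * x j <= x' i * x' j] with the
   denominators cleared. *)
Lemma optimal_pair x l s i j bi bj ci cj :
  opt x l s -> 0 < cost p s -> i != j -> 0 < p i -> 0 < p j ->
  0 <= bi -> 0 <= bj -> bi <= L -> bj <= L -> 0 <= ci -> 0 <= cj ->
  0 < bi + ci -> 0 < bj + cj ->
  bi + bj <= l i + l j -> p i * ci + p j * cj <= p i * s i + p j * s j ->
  (L + s i) * (L + s j) * ((bi + ci) * (bj + cj)) <=
  (L + ci) * (L + cj) * ((l i + s i) * (l j + s j)).
Proof.
move=> o c0 ij pi0 pj0 bi0 bj0 biL bjL ci0 cj0 vi0 vj0 bC cC.
have [ui0 <-] := optimal_eq o c0 pi0; have [uj0 <-] := optimal_eq o c0 pj0.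
have /relaxed_feasibleP [xE lC adm] := o.1.
set ai := (L + ci) / (bi + ci); set aj := (L + cj) / (bj + cj).
have aiE : ai * (bi + ci) = L + ci by rewrite divfK// gt_eqF.
have ajE : aj * (bj + cj) = L + cj by rewrite divfK// gt_eqF.
have xi1 : 1 <= x i by case: (adm i) => -[].
have xj1 : 1 <= x j by case: (adm j) => -[].
have ai1 : 1 <= ai by rewrite ler_pdivlMr//; lra.
have aj1 : 1 <= aj by rewrite ler_pdivlMr//; lra.
rewrite -aiE -ajE.
suff xa : x i * x j <= ai * aj.
  pose d := (bi + ci) * (bj + cj) * ((l i + s i) * (l j + s j)).
  rewrite [leLHS](_ : _ = x i * x j * d); last by rewrite /d; ring.
  rewrite [leRHS](_ : _ = ai * aj * d); last by rewrite /d; ring.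
  by rewrite ler_wpM2r// !mulr_ge0 ?ltW.
rewrite leNgt; apply/negP => ax.
have ij' : j != i by rewrite eq_sym.
have lt : \prod_k update i ai (update j aj x) k < E.
  have xij0 : 0 < x i * x j by rewrite mulr_gt0; lra.
  rewrite -(ltr_pM2l xij0) -[ltLHS]mulrA [x j * _]mulrC mulrA.
  rewrite -{1}(update_neq aj x ij) prod_update -mulrA [X in _ * X]mulrC prod_update.
  rewrite mulrA -(optimal_bandwidth_tight o c0) ltr_pM2r//.
  exact: feasible_prod_gt0 o.1.
have f : feas (update i ai (update j aj x)) (update i bi (update j bj l))
              (update i ci (update j cj s)).
  apply/relaxed_feasibleP; split; first exact: ltW.
    by rewrite !sum_update update_neq//; lra.
  apply: admissible_update; first apply: admissible_update => //.
    by split => // _; rewrite ajE.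
  by split => // _; rewrite aiE.
have cle : cost p (update i ci (update j cj s)) <= cost p s.
  by rewrite !cost_update update_neq//; lra.
have o' := optimal_of_le o f cle.
have c0' : 0 < cost p (update i ci (update j cj s)).
  by apply: lt_le_trans c0 _; exact: o.2 f.
by move: lt; rewrite (optimal_bandwidth_tight o' c0') ltxx.
Qed.

End Optimality.

(** * Small perturbations *)

Section Perturbation.
Variable R : realFieldType.

(** Each pair stands for the affine function [c.1 + t * c.2]. Finitely many strict constraints thus
    survive every small enough step, of either sign. *)
Lemma affine_gt0_near0 (cs : seq (R * R)) : all (fun c => 0 < c.1) cs ->
  exists2 e : R, 0 < e &
    forall t, `|t| <= e -> all (fun c => 0 < c.1 + t * c.2) cs.
Proof.
elim: cs => [_|[a b] cs IH /= /andP[a0 /IH[e e0 he]]]; first by exists 1.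
have b1 : 0 < `|b| + 1 by rewrite ltr_wpDl.
exists (Num.min e (a / (`|b| + 1))); first by rewrite lt_min e0 divr_gt0.
move=> t; rewrite le_min => /andP[te]; rewrite ler_pdivlMr// => tb.
rewrite he// andbT.
have : `|t * b| < a.
  have [->|t0] := eqVneq t 0; first by rewrite mul0r normr0.
  by rewrite normrM; apply: lt_le_trans tb; rewrite ltr_pM2l ?ltrDl// normr_gt0.
by rewrite ltr_norml => /andP[+ _]; lra.
Qed.

(** Near 0 the linear term dominates, and a small [t] of sign opposite to [a] would make the
    polynomial negative. This yields first order conditions without derivatives. *)
Lemma quadratic_ge0_near0 (a b e : R) : 0 < e ->
  (forall t, `|t| <= e -> 0 <= a * t + b * t ^+ 2) -> a = 0.
Proof.
move=> e0 h; apply/eqP; apply: contraT => a0.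
have [|d d0 hd] := @affine_gt0_near0 [:: (`|a|, b)]; first by rewrite /= normr_gt0 a0.
pose m := Num.min d e; have m0 : 0 < m by rewrite lt_min d0.
have md : m <= d by rewrite ge_min lexx.
have me : m <= e by rewrite ge_min lexx orbT.
pose t := - Num.sg a * m.
have nt : `|t| = m by rewrite normrM normrN normr_sg a0 mul1r gtr0_norm.
have := h t; rewrite nt => /(_ me).
have := hd (- m); rewrite normrN gtr0_norm// => /(_ md) /=; rewrite andbT => dm.
have -> : a * t + b * t ^+ 2 = m * (b * m - `|a|).
  by rewrite /t exprMn sqrrN sqr_sg a0 mul1r [`|a|]normrEsg; ring.
rewrite pmulr_rge0// => h1; move: dm h1.
by lra.
Qed.

End Perturbation.

(** * Shape of an optimum of positive cost *)

Section Structure.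
Variables (R : realType) (M : nat) (L E C : R) (p : 'I_M -> R).
Hypothesis L_gt0 : 0 < L.
Hypothesis p_ge0 : forall i, 0 <= p i.
Variables (x l s : 'I_M -> R).
Hypotheses (xls_opt : relaxed_optimal L E C p x l s) (cost_gt0 : 0 < cost p s).

Let adm i : [/\ 1 <= x i, 0 <= l i, l i <= L & 0 <= s i].
Proof. by have [[_ _ b _] _] := xls_opt; have := b i. Qed.

Let eqns i : 0 < p i -> 0 < l i + s i /\ x i * (l i + s i) = L + s i.
Proof. exact: (optimal_eq L_gt0 p_ge0 xls_opt cost_gt0). Qed.

(** If [l i + s i] were larger, moving a little cache from [i] to [j] would bring the two sums
    together and increase their product; with [s] unchanged, bandwidth would be saved. *)
Lemma optimal_water_level i j : 0 < p i -> 0 < p j -> 0 < l i -> l j < L ->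
  l i + s i <= l j + s j.
Proof.
move=> pi pj li lj; rewrite leNgt; apply/negP => lt.
have ij : i != j by apply: contraTneq lt => ->; rewrite ltxx.
have [_ li0 liL si0] := adm i; have [_ lj0 ljL sj0] := adm j.
have [ui _] := eqns pi; have [uj _] := eqns pj.
have [|d d0 hd] := @affine_gt0_near0 R
   [:: (l i, - 1); (L - l j, - 1); (l i + s i - (l j + s j), -1)].
  by rewrite /= li !subr_gt0 lj lt.
have := hd d; rewrite gtr0_norm// => /(_ (lexx _)) /=.
rewrite andbT => /and3P[h1 h2 h3].
have : (L + s i) * (L + s j) * ((l i - d + s i) * (l j + d + s j)) <=
  (L + s i) * (L + s j) * ((l i + s i) * (l j + s j)).
  by apply: (optimal_pair L_gt0 p_ge0 xls_opt cost_gt0) => //; lra.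
rewrite ler_pM2l; last by rewrite mulr_gt0; lra.
rewrite leNgt => /negP; apply.
by nra.
Qed.

(* With [u] the common value of [l + s], the admissible [(s i, s j)] for a given
   total bandwidth are the outside of a convex region, so that bandwidth is
   saved on both sides of a tangent line, and on one of them the linear cost does
   not increase. *)
Lemma optimal_interior_unique i j : 0 < p i -> 0 < p j ->
  0 < l i -> 0 < s i -> 0 < l j -> 0 < s j -> i = j.
Proof.
move=> pi pj li si lj sj; apply/eqP; apply: contraT => ij.
have liL : l i < L by apply: (optimal_cache_lt xls_opt).
have ljL : l j < L by apply: (optimal_cache_lt xls_opt).
have uE : l j + s j = l i + s i.
  by apply/eqP; rewrite eq_le !optimal_water_level.
set u := l i + s i in uE.
pose a := L + s i; pose b := L + s j.
(* Direction tangent to the level curve of the bandwidth [a * b / u ^+ 2] in terms of [(s i, s j)],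
   where [u] is half of the sum of [l i + s i] and [l j + s j], at constant total cache. *)
pose di := - a * (b - u); pose dj := b * (a - u).
have ua : u < a by rewrite /u /a; lra.
have ub : u < b by rewrite -uE /b; lra.
have u0 : 0 < u by rewrite /u; lra.
have [|e e0 he] := @affine_gt0_near0 R
   [:: (s i, di); (s j, dj); (l i, (dj - di) / 2); (l j, (di - dj) / 2);
       (L - l i, (di - dj) / 2); (L - l j, (dj - di) / 2)].
  by rewrite /= si sj li lj !subr_gt0 liL ljL.
(* The sign of [t] selects the side of the tangent on which the cost does not increase. *)
have [t nt tc] : exists2 t, `|t| = e & t * (p i * di + p j * dj) <= 0.
  have [c0|/ltW c0] := leP (p i * di + p j * dj) 0.
    by exists e; rewrite ?gtr0_norm// mulr_ge0_le0// ltW.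
  by exists (- e); rewrite ?normrN ?gtr0_norm// mulr_le0_ge0// oppr_le0 ltW.
have /= := he t; rewrite nt lexx andbT.
move=> /(_ isT) /and5P[h1 h2 h3 h4 /andP[h5 h6]].
have dE : di + dj = u * (a - b) by rewrite /di /dj; ring.
have t0 : t != 0 by rewrite -normr_gt0 nt.
(* The cache shifted between the two videos keeps their sums [l + s] equal. *)
have : (L + s i) * (L + s j) * ((l i + t * ((dj - di) / 2) + (s i + t * di)) *
     (l j + t * ((di - dj) / 2) + (s j + t * dj))) <=
   (L + (s i + t * di)) * (L + (s j + t * dj)) * ((l i + s i) * (l j + s j)).
  by apply: (optimal_pair L_gt0 p_ge0 xls_opt cost_gt0) => //; lra.
rewrite [l j + s j]uE -/u.
have uE' : u * (1 + t * (a - b) / 2) = u + t * (di + dj) / 2.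
  by rewrite dE; field.
have -> : l i + t * ((dj - di) / 2) + (s i + t * di) = u * (1 + t * (a - b) / 2).
  by rewrite uE' /u; field.
have -> : l j + t * ((di - dj) / 2) + (s j + t * dj) = u * (1 + t * (a - b) / 2).
  by rewrite uE' -uE; field.
rewrite leNgt => /negP; case.
rewrite !addrA -/a -/b -subr_gt0.
set lhs := (X in 0 < X).
(* The first order terms cancel by tangency, and the second order gain is a nonzero square. *)
have -> : lhs = a * b * u ^+ 2 * (t * (a - u + (b - u)) / 2) ^+ 2.
  by rewrite /lhs /di /dj; field.
have abu : 0 < a - u + (b - u) by lra.
have a0 : 0 < a by lra.
have b0 : 0 < b by lra.
apply: mulr_gt0; first by rewrite !mulr_gt0// exprn_gt0.
by rewrite lt0r sqr_ge0 andbT expf_neq0// !mulf_neq0// ?gt_eqF// invr_gt0.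
Qed.

(** When [s] vanishes the water level is the cache size itself, and a video at the cap [L] cannot be
    exceeded. *)
Lemma optimal_saturated_eq i j : 0 < p i -> 0 < p j -> s i = 0 -> s j = 0 ->
  l i = l j.
Proof.
suff h : forall i j, 0 < p i -> 0 < p j -> s i = 0 -> s j = 0 -> l i <= l j.
  by move=> pi pj si sj; apply/eqP; rewrite eq_le !h.
move=> {}i {}j pi pj si sj.
have [ui _] := eqns pi; rewrite si addr0 in ui.
have [_ _ lL _] := adm i.
have [ljL|] := ltP (l j) L; last exact: le_trans.
by have := optimal_water_level pi pj ui ljL; rewrite si sj !addr0.
Qed.

(** This makes the cache of the threshold video a remainder modulo the common size [l1]. *)
Lemma optimal_interior_lt i j : 0 < p i -> 0 < p j -> 0 < s i -> s j = 0 ->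
  l i < l j.
Proof.
move=> pi pj si sj; have liL := optimal_cache_lt xls_opt pi si.
have [uj _] := eqns pj; rewrite sj addr0 in uj.
have [ljL|Llj] := ltP (l j) L; last exact: lt_le_trans Llj.
have [_ li0 _ _] := adm i.
have [li|] := ltP 0 (l i); last by move=> li; apply: le_lt_trans uj.
by have := optimal_water_level pi pj li ljL; rewrite sj; lra.
Qed.

(** First order condition along the direction [(p j, - p i)] for [(s i, s j)], which keeps the cost,
    with the caches fixed. *)
Lemma optimal_stationary i j : 0 < p i -> 0 < p j -> 0 < s i -> 0 < s j ->
  p i * (L + s i) * (l i + s i) * (L - l j) =
  p j * (L + s j) * (l j + s j) * (L - l i).
Proof.
move=> pi pj si sj; have [->//|ij] := eqVneq i j.
have [_ li0 liL _] := adm i; have [_ lj0 ljL _] := adm j.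
have [|e e0 he] := @affine_gt0_near0 R [:: (s i, p j); (s j, - p i)].
  by rewrite /= si sj.
pose a := L + s i; pose b := L + s j; pose u := l i + s i; pose v := l j + s j.
apply/eqP; rewrite -subr_eq0; apply/eqP.
(* The inequality of [optimal_pair] is quadratic in [t] without constant term; its linear
   coefficient is the difference of the two sides of the goal. *)
apply: (@quadratic_ge0_near0 _ _ (p i * p j * (a * b - u * v)) e e0) => t te.
have /= := he t te; rewrite andbT => /andP[h1 h2].
have : (L + s i) * (L + s j) *
     ((l i + (s i + t * p j)) * (l j + (s j + t * - p i))) <=
   (L + (s i + t * p j)) * (L + (s j + t * - p i)) * ((l i + s i) * (l j + s j)).
  by apply: (optimal_pair L_gt0 p_ge0 xls_opt cost_gt0) => //; lra.
rewrite -subr_ge0; congr (_ <= _); rewrite /a /b /u /v; ring.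
Qed.

End Structure.

(** * Sorting an optimum by waiting time *)

Section Sorting.
Variables (R : realType) (M : nat).

Lemma sum_mul_tperm (w f : 'I_M -> R) i j : i != j ->
  \sum_k w k * f (tperm i j k) =
  \sum_k w k * f k + (w i - w j) * (f j - f i).
Proof.
move=> ij; have ji : j != i by rewrite eq_sym.
rewrite (bigD1 i)//= (bigD1 j)//= [X in _ = X + _](bigD1 i)//=.
rewrite [X in _ = _ + X + _](bigD1 j)//= tpermL tpermR.
rewrite (eq_bigr (fun k => w k * f k)); first by ring.
by move=> k /andP[ki kj]; rewrite tpermD// eq_sym.
Qed.

Variables (L E C : R) (p : 'I_M -> R).
Hypotheses (L_gt0 : 0 < L) (E_gt1 : 1 < E) (C_gt0 : 0 < C).
Hypotheses (p_ge0 : forall i, 0 <= p i) (p_sum1 : \sum_i p i = 1).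
Hypothesis p_noninc : forall i j : 'I_M, (i <= j)%N -> p j <= p i.

(** The cost changes by [(p i - p j) * (s j - s i)], which is at most 0. By [0 < p j], both
    exchanged videos are popular, so that their constraints hold and can be transported. *)
Lemma relaxed_optimal_swap x l s (i j : 'I_M) : relaxed_optimal L E C p x l s ->
  (i < j)%N -> 0 < p j -> s j <= s i ->
  relaxed_optimal L E C p
    (x \o tperm i j) (l \o tperm i j) (s \o tperm i j).
Proof.
move=> o ij pj sji; have [fx fl b f] := o.1.
have pij := p_noninc (ltnW ij).
apply: (optimal_of_le o).
  split => [||k|k pk] /=.
  - by have := fx; rewrite (reindex_inj (@perm_inj _ (tperm i j))).
  - by have := fl; rewrite (reindex_inj (@perm_inj _ (tperm i j))).
  - exact: b.
  - apply: f; case: tpermP => // _; exact: lt_le_trans pij.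
rewrite /cost/= sum_mul_tperm ?neq_ltn ?ij// gerDl.
by rewrite mulr_ge0_le0 ?subr_ge0 ?subr_le0.
Qed.

(** Among the permutations that preserve optimality, one maximizing [F] is sorted: exchanging an
    inverted pair would preserve optimality and increase [F]. *)
Lemma relaxed_optimal_sorted : exists x l s, relaxed_optimal L E C p x l s /\
  forall i j : 'I_M, (i <= j)%N -> 0 < p j -> s i <= s j.
Proof.
have [x [l [s o]]] := relaxed_optimal_exists L_gt0 E_gt1 C_gt0 p_ge0 p_sum1.
pose Q (t : 'S_M) := `[< relaxed_optimal L E C p (x \o t) (l \o t) (s \o t) >].
pose F (t : 'S_M) : R := \sum_(k < M) k%:R * s (t k).
have Q1 : Q 1%g.
  have cE (f : 'I_M -> R) : f \o (1%g : 'S_M) = f.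
    by apply/funext => k; rewrite /= perm1.
  by apply/asboolP; rewrite !cE.
case: (arg_maxP F Q1) => t /asboolP ot Fmax.
exists (x \o t), (l \o t), (s \o t); split => // i j.
rewrite leq_eqVlt => /orP[/eqP/val_inj->//|ij] pj.
rewrite leNgt; apply/negP => sji.
have cE (f : 'I_M -> R) : (f \o t) \o tperm i j = f \o (tperm i j * t)%g.
  by apply/funext => k; rewrite /= permM.
have := relaxed_optimal_swap ot ij pj (ltW sji).
rewrite !cE => /asboolP /Fmax /=.
rewrite /F; under [leLHS]eq_bigr do rewrite permM.
rewrite (@sum_mul_tperm (fun k => k%:R) (s \o t)) ?neq_ltn ?ij//=.
rewrite leNgt ltrDl nmulr_rgt0 ?subr_lt0 ?ltr_nat// sji.
by [].
Qed.

End Sorting.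

(** * Initial segments, the cache allocation and the multiplier formula *)

Lemma initial_segment (M : nat) (D : pred 'I_M) :
  (forall i j : 'I_M, (i <= j)%N -> D j -> D i) ->
  exists2 n, (n <= M)%N & forall i : 'I_M, D i = (i < n)%N.
Proof.
move=> Ddown.
have exn : exists n, [forall i : 'I_M, D i ==> (i < n)%N].
  by exists M; apply/forallP => i; rewrite ltn_ord implybT.
case: (ex_minnP exn) => n /forallP nP nmin; exists n.
  by apply: nmin; apply/forallP => i; rewrite ltn_ord implybT.
move=> i; apply/idP/idP => [Di|]; first exact: implyP (nP i) Di.
case: n nP nmin => // n nP nmin lein; apply: contraT => nDi.
suff /nmin : [forall j : 'I_M, D j ==> (j < n)%N] by rewrite ltnn.
apply/forallP => j; apply/implyP => Dj; rewrite ltnNge; apply/negP => nj.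
by rewrite (Ddown i j) in nDi => //; exact: leq_trans nj.
Qed.

Lemma sum_threshold (R : nzRingType) (M n : nat) (a c : R) :
  \sum_(i < M) (if (i < n)%N then a else if i == n :> nat then c else 0) =
  (minn n M)%:R * a + (if (n < M)%N then c else 0).
Proof.
elim: M => [|M IH]; first by rewrite big_ord0 minn0 mul0r addr0.
rewrite big_ord_recr/= IH ltnS [M == n]eq_sym.
have [nM|Mn|<-] := ltngtP n M.
- by rewrite (minn_idPl (leqW (ltnW nM))) addr0.
- by rewrite (minn_idPr Mn) mulrS mulrDl mul1r !addr0 addrC.
- by rewrite (minn_idPl (leqnSn n)) addr0.
Qed.

Section CacheAllocation.
Variables (R : realType) (M : nat) (C l1 : R).
Hypotheses (l1_gt0 : 0 < l1) (C_gt0 : 0 < C).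

Lemma full_videosP n c : C = n%:R * l1 + c -> 0 <= c < l1 ->
  full_videos C l1 = n.
Proof.
move=> -> /andP[c0 c1]; apply: truncn_def.
by rewrite ler_pdivlMr// ltr_pdivrMr// -natr1 mulrDl mul1r lerDl ltrD2l c0.
Qed.

Lemma full_videos_itv :
  (full_videos C l1)%:R * l1 <= C < (full_videos C l1)%:R * l1 + l1.
Proof.
have /truncn_itv : 0 <= C / l1 by rewrite divr_ge0// ltW.
by rewrite ler_pdivlMr// ltr_pdivrMr// -natr1 mulrDl mul1r.
Qed.

Lemma cache_allocation_itv (i : 'I_M) : 0 <= cache_allocation C l1 i <= l1.
Proof.
have /andP[h1 h2] := full_videos_itv.
rewrite /cache_allocation; case: ifP => _; first by rewrite lexx ltW.
by case: ifP => _; rewrite ?lexx ?(ltW l1_gt0)// mulrC subr_ge0 h1 lerBlDl ltW.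
Qed.

Lemma cache_allocation_sum : \sum_(i < M) cache_allocation C l1 i <= C.
Proof.
have /andP[h1 h2] := full_videos_itv.
rewrite sum_threshold; have [nM|Mn] := ltnP (full_videos C l1) M.
  by rewrite mulrC addrC subrK.
by rewrite addr0 (le_trans _ h1)// ler_pM2r// ler_nat.
Qed.

End CacheAllocation.

(** The roots of [x ^+ 2 - (2 + c) * x + 1] have product 1, so a root that is at least 1 is the
    larger one, with the sign [+] before the square root. *)
Lemma multiplier_root (R : realType) (c x : R) : 1 <= x -> (x - 1) ^+ 2 = c * x ->
  (2 + c + Num.sqrt (c ^+ 2 + 4 * c)) / 2 = x.
Proof.
move=> x1 cx.
have h : 0 <= 2 * x - 2 - c.
  have x0 : 0 < x by lra.
  rewrite -(pmulr_rge0 _ x0).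
  have -> : x * (2 * x - 2 - c) = (x - 1) * (x + 1).
    by rewrite !mulrBr [x * c]mulrC -cx; ring.
  by rewrite mulr_ge0; lra.
have -> : c ^+ 2 + 4 * c = (2 * x - 2 - c) ^+ 2.
  rewrite [RHS](_ : _ = c ^+ 2 + 4 * (x - 1) ^+ 2 - 4 * (c * x) + 4 * c); last by ring.
  by rewrite cx; ring.
by rewrite sqrtr_sqr ger0_norm//; field.
Qed.

(** * The sorted optimum in threshold form *)

Section Threshold.
Variables (R : realType) (M : nat) (L E C : R) (p : 'I_M -> R).
Hypotheses (L_gt0 : 0 < L) (C_gt0 : 0 < C).
Hypothesis p_ge0 : forall i, 0 <= p i.
Hypothesis p_noninc : forall i j : 'I_M, (i <= j)%N -> p j <= p i.
Variables (x l s : 'I_M -> R).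
Hypotheses (xls_opt : relaxed_optimal L E C p x l s) (cost_gt0 : 0 < cost p s).
Hypothesis s_nondec : forall i j : 'I_M, (i <= j)%N -> 0 < p j -> s i <= s j.

(** Suppose [0 < l i] and compare with video [n]. If that one has cache too,
    [optimal_interior_unique] forces [i = n]; if it has none, the water level gives
    [l i + s i <= s n], while [s n <= s i]. *)
Lemma optimal_cache_eq0 n (i : 'I_M) :
  (forall j : 'I_M, (0 < p j) && (s j == 0) = (j < n)%N) -> (n < i)%N -> l i = 0.
Proof.
move=> nP ni; have [_ _ b _] := xls_opt.1.
have [pi|] := ltP 0 (p i); last first.
  move=> pi; have {}pi : p i = 0 by apply/eqP; rewrite eq_le pi p_ge0.
  by have [_ ->] := optimal_unpopular L_gt0 p_ge0 xls_opt cost_gt0 pi.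
pose j := Ordinal (ltn_trans ni (ltn_ord i)).
have pj : 0 < p j by apply: lt_le_trans (p_noninc _); [exact: pi|exact: ltnW].
have sgt0 k : 0 < p k -> (n <= k)%N -> 0 < s k.
  move=> pk nk; have := nP k; rewrite pk ltnNge nk/= => sk.
  by rewrite lt0r sk; have [] := b k.
have sj : 0 < s j by apply: sgt0.
have si : 0 < s i by apply: sgt0 => //; exact: ltnW.
have [_ lj0 _ _] := b j; have [_ li0 _ _] := b i.
have [li|li] := ltP 0 (l i); last by apply/eqP; rewrite eq_le li li0.
have [lj|lj] := ltP 0 (l j).
  have := optimal_interior_unique L_gt0 p_ge0 xls_opt cost_gt0 pj pi lj sj li si.
  by move=> /(congr1 val)/= nE; move: (ni); rewrite -nE ltnn.
have ljL := optimal_cache_lt xls_opt pj sj.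
have := optimal_water_level L_gt0 p_ge0 xls_opt cost_gt0 pi pj li ljL.
by have := @s_nondec j i (ltnW ni) pi; lra.
Qed.

Lemma optimal_multiplier n :
  (forall j : 'I_M, (0 < p j) && (s j == 0) = (j < n)%N) ->
  exists2 beta, 0 <= beta & forall i : 'I_M, (n <= i)%N ->
    let c := p i * beta * (L - l i) in
    (2 + c + Num.sqrt (c ^+ 2 + 4 * c)) / 2 = x i.
Proof.
move=> nP; have [_ _ b _] := xls_opt.1.
have [k pks] := cost_gt0_witness cost_gt0.
have pk : 0 < p k.
  by rewrite lt0r p_ge0 andbT; apply: contraTneq pks => ->; rewrite mul0r ltxx.
have sk : 0 < s k by rewrite -(pmulr_rgt0 _ pk).
have lk := optimal_cache_lt xls_opt pk sk.
have [uk xuk] := optimal_eq L_gt0 p_ge0 xls_opt cost_gt0 pk.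
have dk : 0 < p k * (L + s k) * (l k + s k) by rewrite !mulr_gt0// addr_gt0.
(* With [x = (L + s) / (l + s)], the equation [(x - 1) ^+ 2 = p * beta * (L - l) * x] solves to this
   value of [beta]; by [optimal_stationary] it is the same for all popular videos with [0 < s]. *)
exists ((L - l k) / (p k * (L + s k) * (l k + s k))).
  by apply: divr_ge0; [rewrite subr_ge0|]; exact: ltW.
move=> i ni c; have [x1 _ _ s0] := b i; apply: multiplier_root => //.
have [pi|] := ltP 0 (p i); last first.
  move=> pi; have {}pi : p i = 0 by apply/eqP; rewrite eq_le pi p_ge0.
  have [-> _] := optimal_unpopular L_gt0 p_ge0 xls_opt cost_gt0 pi.
  by rewrite /c pi !mul0r subrr expr0n.
have si : 0 < s i.
  by have := nP i; rewrite pi ltnNge ni/= => si; rewrite lt0r si.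
have [ui xui] := optimal_eq L_gt0 p_ge0 xls_opt cost_gt0 pi.
have st := optimal_stationary L_gt0 p_ge0 xls_opt cost_gt0 pi pk si sk.
apply: (mulIf (x := (l i + s i) ^+ 2)); first by rewrite expf_neq0// gt_eqF.
rewrite -exprMn mulrBl mul1r xui.
rewrite (_ : c * x i * _ = c * (x i * (l i + s i)) * (l i + s i)); last by ring.
rewrite xui /c.
rewrite (_ : _ * _ * (L - l i) * _ * _ =
    (L - l i) * (p i * (L + s i) * (l i + s i) * (L - l k)) /
    (p k * (L + s k) * (l k + s k))); last first.
  by field; rewrite !gt_eqF// addr_gt0.
by rewrite st; field; rewrite !gt_eqF// addr_gt0.
Qed.

Lemma optimal_threshold : exists n l1 beta,
  [/\ saturated_number L C l1 n, search_interval M L C l1 /\ 0 < l1, 0 <= beta,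
      l = cache_allocation C l1 &
      forall i : 'I_M, x i =
        if (i < n)%N then L / l1 else
          let c := p i * beta * (L - l i) in
          (2 + c + Num.sqrt (c ^+ 2 + 4 * c)) / 2].
Proof.
have [_ _ b _] := xls_opt.1.
have Cl := optimal_cache_tight p_ge0 xls_opt cost_gt0.
have [|n nM nP] := @initial_segment M (fun i => (0 < p i) && (s i == 0)).
  move=> i j ij /andP[pj /eqP sj]; rewrite (lt_le_trans pj (p_noninc ij))/=.
  rewrite eq_le -{1}sj s_nondec//=.
  by have [] := b i.
have [beta beta0 betaP] := optimal_multiplier nP.
have l0 := optimal_cache_eq0 nP.
have M0 : (0 < M)%N.
  by have [i _] := cost_gt0_witness cost_gt0; exact: leq_ltn_trans (ltn_ord i).
have minM (y : R) : 0 <= y -> y / M%:R <= y.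
  by move=> y0; rewrite ler_pdivrMr ?ltr0n// ler_peMr// ler1n.
(* If no popular video has [s i = 0], the first video receives the whole cache and [l1 = C]. Then
   [full_videos C C] is 1, not 0, whence the second case of [saturated_number]. *)
have [n0|n0] := posnP n.
  have lE (i : 'I_M) : l i = if i == 0 :> nat then l (Ordinal M0) else 0.
    case: eqP => [i0|/eqP i0]; first by congr l; exact: val_inj.
    by apply: l0; rewrite n0 lt0n.
  have lC : l (Ordinal M0) = C.
    rewrite -Cl (bigD1 (Ordinal M0))//= big1 ?addr0// => i i0.
    by apply: l0; rewrite n0 lt0n.
  have CL : C <= L by rewrite -lC; have [] := b (Ordinal M0).
  have fv : full_videos C C = 1%N.
    by apply: (@full_videosP _ _ _ C_gt0 _ 0); rewrite ?mul1r ?addr0// lexx.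
  exists n, C, beta; split => //.
  - by right.
  - split => //; rewrite /search_interval/= (min_idPr CL) lexx andbT.
    by rewrite minM// ltW.
  - apply/funext => i; rewrite lE /cache_allocation fv lC mulr1 subrr ltnS leqn0.
    by case: ifP => // _; case: ifP.
  - by move=> i; rewrite n0 ltn0; apply/esym/betaP; rewrite n0.
pose o := Ordinal M0; pose l1 := l o.
have D (i : 'I_M) : (i < n)%N -> 0 < p i /\ s i = 0.
  by rewrite -nP => /andP[? /eqP].
have [po so] := D o n0.
have l1E (i : 'I_M) : (i < n)%N -> l i = l1.
  by move=> /D[pi si]; apply: (optimal_saturated_eq L_gt0 p_ge0 xls_opt cost_gt0).
have l1_gt0 : 0 < l1.
  by have [] := optimal_eq L_gt0 p_ge0 xls_opt cost_gt0 po; rewrite so addr0.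
(* The cache [c] of the threshold video is what remains after [n] shares [l1]. For [n = M] there is
   no such video and [c = 0]. *)
have [c cP [cM c01]] : exists2 c, (forall i : 'I_M, i = n :> nat -> l i = c) &
    (if (n < M)%N then c else 0) = c /\ 0 <= c < l1.
  have [nM'|Mn] := ltnP n M; last first.
    exists 0 => [i ni|]; last by rewrite lexx.
    by move: (ltn_ord i); rewrite ni ltnNge Mn.
  pose k := Ordinal nM'; exists (l k).
    by move=> i ni; congr l; exact: val_inj.
  split => //; have [_ lk0 _ sk0] := b k; rewrite lk0/=.
  have [pk|pk] := ltP 0 (p k).
    apply: (optimal_interior_lt L_gt0 p_ge0 xls_opt cost_gt0) => //.
    have := nP k; rewrite pk/= ltnn => sk.
    by rewrite lt0r sk.
  have {}pk : p k = 0 by apply/eqP; rewrite eq_le pk p_ge0.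
  by have [_ ->] := optimal_unpopular L_gt0 p_ge0 xls_opt cost_gt0 pk.
have lE (i : 'I_M) : l i = if (i < n)%N then l1 else if i == n :> nat then c else 0.
  have [/l1E//|ni|/cP//] := ltngtP i n.
  exact: l0.
have CE : C = n%:R * l1 + c.
  by rewrite -Cl (eq_bigr _ (fun i _ => lE i)) sum_threshold (minn_idPl nM) cM.
have fv := full_videosP l1_gt0 CE c01; move: c01 => /andP[c0 c1].
have l1L : l1 <= L by have [] := b o.
have l1C : l1 <= C.
  by rewrite CE ler_wpDr// ler_peMl ?ler1n// ltW.
exists n, l1, beta; split => //.
- by left.
- split => //; rewrite /search_interval/= le_min l1L l1C !andbT.
  (* The lower end of the interval comes from [C = n * l1 + c <= M * l1]. *)
  rewrite ler_pdivrMr ?ltr0n//; apply: (@le_trans _ _ C); first by rewrite ge_min lexx orbT.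
  rewrite CE [l1 * _]mulrC; have [nM'|Mn] := ltnP n M.
    apply: (@le_trans _ _ (n.+1%:R * l1)).
      by rewrite -natr1 mulrDl mul1r lerD2l ltW.
    by rewrite ler_pM2r// ler_nat.
  by move: cM; rewrite ltnNge Mn/= => <-; rewrite addr0 ler_pM2r// ler_nat.
- apply/funext => i; rewrite lE /cache_allocation fv CE mulrC.
  by rewrite addrAC subrr add0r.
- move=> i; case: ifP => [ni|/negbT]; last by rewrite -leqNgt => /betaP.
  have [pi si] := D i ni.
  have [ui] := optimal_eq L_gt0 p_ge0 xls_opt cost_gt0 pi.
  by rewrite si !addr0 (l1E _ ni) => <-; rewrite mulfK// gt_eqF.
Qed.

End Threshold.

(** * Waiting time of one video and the relaxed constraint *)

Section WaitingTime.
Variables (R : realType) (L r fB : R).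
Hypotheses (r_gt0 : 0 < r) (fB_gt0 : 0 < fB).

(** A finite waiting time [s / r] satisfies the relaxed constraint with equality. Without bandwidth
    the denominator is 0, and the value is 0 for [l = L] and infinite otherwise. *)
Lemma waiting_time_lower b l : 0 <= b -> 0 <= l <= L * expR (- (fB / r * b)) ->
  waiting_time L r fB b l = +oo%E \/
  exists s, [/\ 0 <= s, waiting_time L r fB b l = (s / r)%:E &
    L + s <= expR (fB / r * b) * (l + s)].
Proof.
move=> b0 /andP[l0]; rewrite expRN /waiting_time.
set e := expR _; have e1 : 1 <= e.
  by rewrite /e -[leLHS]expR0 ler_expR mulr_ge0// divr_ge0// ltW.
have e0 : 0 < e by exact: expR_gt0.
rewrite ler_pdivlMr// mulrC => elL; rewrite inver mulf_eq0 gt_eqF//= subr_eq0.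
case: eqP => [->|/eqP ene].
  rewrite !mul1r; have [lL|] := eqVneq l L.
    right; exists 0; rewrite lL subrr mul0e mul0r; split => //.
    by rewrite mul1r.
  move=> lL; left; rewrite gt0_muley// lte_fin subr_gt0 lt_neqAle lL/=.
  by apply: le_trans elL; rewrite ler_peMl.
have {}e1 : 0 < e - 1 by rewrite subr_gt0 lt_neqAle eq_sym ene.
right; exists ((L - e * l) / (e - 1)); split.
- by apply: divr_ge0; [rewrite subr_ge0|exact: ltW].
- by rewrite -EFinM; congr EFin; field; rewrite !gt_eqF.
- rewrite -subr_ge0 le_eqVlt; apply/orP; left; apply/eqP; field.
  by rewrite gt_eqF.
Qed.

(** For [x = 1] the two constraints force [l = L], so that the numerator vanishes. *)
Lemma waiting_time_upper x l s : 1 <= x -> 0 <= s -> x * l <= L ->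
  L + s <= x * (l + s) ->
  (waiting_time L r fB (r / fB * ln x) l <= (s / r)%:E)%E.
Proof.
move=> x1 s0 xlL Ls; have x0 : 0 < x by exact: lt_le_trans x1.
rewrite /waiting_time mulrA (_ : fB / r * (r / fB) = 1); last first.
  by field; rewrite !gt_eqF.
rewrite mul1r lnK ?posrE// inver mulf_eq0 gt_eqF//= subr_eq0.
case: eqP => [xE|/eqP xne].
  have -> : L - x * l = 0 by apply/eqP; rewrite xE in xlL Ls *; lra.
  by rewrite mul0e lee_fin divr_ge0// ltW.
have {}x1 : 0 < x - 1 by rewrite subr_gt0 lt_neqAle eq_sym xne.
rewrite -EFinM lee_fin invfM mulrCA mulrC ler_pM2r ?invr_gt0//.
by rewrite ler_pdivrMr//; lra.
Qed.

End WaitingTime.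

(** * Comparing the allocation problem with the relaxed one *)

Section Reduction.
Variables (R : realType) (M : nat) (L r fB B C : R) (p : 'I_M -> R).
Hypotheses (L_gt0 : 0 < L) (r_gt0 : 0 < r) (fB_gt0 : 0 < fB).
Hypothesis p_ge0 : forall i, 0 <= p i.

Notation E := (expR (fB / r * B)).

(** Either a popular video waits forever and the average is infinite, or the finite waiting times of
    the popular videos make a relaxed feasible triple of the same cost, up to the factor [r]. *)
Lemma avg_waiting_time_lower v b l :
  (forall x' l' s', relaxed_feasible L E C p x' l' s' -> v <= cost p s') ->
  feasible L r fB B C b l -> ((v / r)%:E <= avg_waiting_time L r fB p b l)%E.
Proof.
move=> vmin [bB lC b0 lb].
have lower i := waiting_time_lower r_gt0 fB_gt0 (b0 i) (lb i).
have term_ge0 i : (0 <= (p i)%:E * waiting_time L r fB (b i) (l i))%E.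
  apply: mule_ge0; first by rewrite lee_fin.
  by case: (lower i) => [->//|[s [s0 -> _]]]; rewrite lee_fin divr_ge0// ltW.
have [[i [pi wi]]|finite] :=
    pselect (exists i, 0 < p i /\ waiting_time L r fB (b i) (l i) = +oo%E).
  rewrite /avg_waiting_time (bigD1 i)//= wi gt0_muley ?lte_fin//.
  rewrite addye ?leey// gt_eqF// (lt_le_trans (ltNyr 0))//.
  by apply: sume_ge0.
have exs i : exists s, 0 <= s /\ (0 < p i ->
    waiting_time L r fB (b i) (l i) = (s / r)%:E /\
    L + s <= expR (fB / r * b i) * (l i + s)).
  case: (lower i) => [wi|[s [? ? ?]]]; last by exists s.
  (* An infinite waiting time is left only to unpopular videos, where [0 * +oo = 0] and any [s] will
     do. *)
  exists 0; split => // pi; exfalso; apply: finite; by exists i.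
have [s sP] := choice exs.
have -> : avg_waiting_time L r fB p b l = (cost p s / r)%:E.
  rewrite /avg_waiting_time /cost mulr_suml -sumEFin; apply: eq_bigr => i _.
  have [pi|pi] := ltP 0 (p i); last first.
    have -> : p i = 0 by apply/eqP; rewrite eq_le pi p_ge0.
    by rewrite !mul0r mul0e.
  by have [_ /(_ pi)[-> _]] := sP i; rewrite -EFinM mulrA.
rewrite lee_fin ler_pM2r ?invr_gt0//.
apply: (vmin (fun i => expR (fB / r * b i)) l); split => //.
- rewrite -expR_sum ler_expR -mulr_sumr ler_pM2l// divr_gt0//.
- move=> i; have /andP[l0 ll] := lb i; have [s0 _] := sP i; split => //.
    by rewrite -[leLHS]expR0 ler_expR mulr_ge0// divr_ge0// ltW.
  apply: le_trans ll _; rewrite ger_pMr// -expR0 ler_expR oppr_le0.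
  by rewrite mulr_ge0// divr_ge0// ltW.
- by move=> i pi; have [_ /(_ pi)[_]] := sP i.
Qed.

Lemma avg_waiting_time_upper x l s :
  (forall i, [/\ 1 <= x i, 0 <= s i & 0 < p i ->
     x i * l i <= L /\ L + s i <= x i * (l i + s i)]) ->
  (avg_waiting_time L r fB p (fun i => (r / fB * ln (x i))%R) l <=
   (cost p s / r)%:E)%E.
Proof.
move=> h; rewrite /avg_waiting_time /cost mulr_suml -sumEFin.
apply: lee_sum => i _; have [x1 s0 c] := h i.
have [pi|pi] := ltP 0 (p i); last first.
  have -> : p i = 0 by apply/eqP; rewrite eq_le pi p_ge0.
  by rewrite !mul0r mul0e.
have [c1 c2] := c pi.
rewrite -[p i * s i / r]mulrA EFinM; apply: lee_wpmul2l; first by rewrite lee_fin.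
exact: waiting_time_upper.
Qed.

Lemma expR_bandwidth (x : R) : 0 < x ->
  expR (- (fB / r * (r / fB * ln x))) = x^-1.
Proof.
move=> x0; rewrite mulrA (_ : fB / r * (r / fB) = 1).
  by rewrite mul1r expRN lnK.
by field; rewrite !gt_eqF.
Qed.

Lemma feasible_ln (x l : 'I_M -> R) :
  (forall i, 1 <= x i) -> (forall i, 0 <= l i) -> (forall i, x i * l i <= L) ->
  \prod_i x i <= E -> \sum_i l i <= C ->
  feasible L r fB B C (fun i => r / fB * ln (x i)) l.
Proof.
move=> x1 l0 xl xE lC.
have x0 i : 0 < x i by exact: lt_le_trans (x1 i).
split => // [|i|i].
- rewrite -mulr_sumr -ler_pdivlMl ?divr_gt0// invf_div -ler_expR expR_sum.
  by under eq_bigr do rewrite lnK ?posrE//.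
- by rewrite mulr_ge0 ?ln_ge0// divr_ge0// ltW.
- rewrite l0/= expR_bandwidth// ler_pdivlMr// mulrC; exact: xl.
Qed.

End Reduction.

(** * An optimal allocation of the required form *)

Section Existence.
Variables (R : realType) (M : nat) (L r fB B C : R) (p : 'I_M -> R).
Hypotheses (L_gt0 : 0 < L) (r_gt0 : 0 < r) (fB_gt0 : 0 < fB) (B_gt0 : 0 < B).
Hypothesis C_gt0 : 0 < C.
Hypothesis p_ge0 : forall i, 0 <= p i.
Hypothesis p_noninc : forall i j : 'I_M, (i <= j)%N -> p j <= p i.
Hypothesis p_sum1 : \sum_i p i = 1.

Notation E := (expR (fB / r * B)).

(** The finiteness of the value serves to show that the infimum in [phi] is attained at every
    minimizer. *)
Definition structured_optimum l1 b : Prop :=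
  [/\ search_interval M L C l1, induced_bandwidth L r fB B C p l1 b,
      optimal_allocation L r fB B C p b (cache_allocation C l1) &
      (avg_waiting_time L r fB p b (cache_allocation C l1) < +oo)%E].

Lemma structured_optimum_positive x l s : relaxed_optimal L E C p x l s ->
  0 < cost p s -> (forall i j : 'I_M, (i <= j)%N -> 0 < p j -> s i <= s j) ->
  exists l1 b, structured_optimum l1 b.
Proof.
move=> o c0 s_nondec; have [xE lC bnd _] := o.1.
have [n [l1 [beta [sat [l1I l1_gt0] beta0 lE xP]]]] :=
  optimal_threshold L_gt0 C_gt0 p_ge0 p_noninc o c0 s_nondec.
have x1 i : 1 <= x i by have [] := bnd i.
have x0 i : 0 < x i by exact: lt_le_trans (x1 i).
have xlL i : x i * l i <= L.
  have [_ _ _ s0] := bnd i; have [pi|pi] := ltP 0 (p i).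
    have [_ xu] := optimal_eq L_gt0 p_ge0 o c0 pi.
    by have := mulr_ge0 s0 (_ : 0 <= x i - 1); rewrite subr_ge0 x1 => /(_ isT); lra.
  have {}pi : p i = 0 by apply/eqP; rewrite eq_le pi p_ge0.
  by have [_ ->] := optimal_unpopular L_gt0 p_ge0 o c0 pi; rewrite mulr0 ltW.
have feas : feasible L r fB B C (fun i => r / fB * ln (x i)) l.
  by apply: feasible_ln => // i; have [] := bnd i.
have up : (avg_waiting_time L r fB p (fun i => (r / fB * ln (x i))%R) l <=
    (cost p s / r)%:E)%E.
  apply: avg_waiting_time_upper => // i; have [_ _ _ s0] := bnd i; split => // pi.
  by have [_ ->] := optimal_eq L_gt0 p_ge0 o c0 pi.
exists l1, (fun i => r / fB * ln (x i)); rewrite /structured_optimum -lE; split => //.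
- exists n, beta; rewrite -lE; split => //.
    apply/funext => i; rewrite /bandwidth_allocation xP -lE.
    by case: ifP.
  move=> _; rewrite -mulr_sumr.
  have -> : \sum_(i < M) ln (x i) = fB / r * B.
    apply: expR_inj; rewrite expR_sum -(optimal_bandwidth_tight p_ge0 o c0).
    by apply: eq_bigr => i _; rewrite lnK ?posrE.
  by field; rewrite !gt_eqF.
- split => // b' l' feas'; apply: le_trans up _.
  apply: (avg_waiting_time_lower L_gt0 r_gt0 fB_gt0 p_ge0 _ feas') => x2 l2 s2.
  exact: o.2.
- by apply: le_lt_trans up _; rewrite ltry.
Qed.

(** The popular videos are the first [m], all with [L <= x i * l i]. By the inequality of means,
    equal shares of the cache need no more bandwidth. *)
Lemma structured_optimum_zero x l s : relaxed_optimal L E C p x l s ->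
  cost p s = 0 -> exists l1 b, structured_optimum l1 b.
Proof.
move=> o c0; have [xE lC bnd loc] := o.1.
have [|m mM mP] := @initial_segment M (fun i => 0 < p i).
  by move=> i j ij pj; apply: lt_le_trans (p_noninc ij).
have m0 : (0 < m)%N.
  rewrite lt0n; apply/eqP => m0.
  have : \sum_i p i <= 0 by apply: sumr_le0 => i _; rewrite leNgt mP m0.
  by rewrite p_sum1 ler10.
have M0 : (0 < M)%N by exact: leq_trans mM.
have pm (i : 'I_M) : (m <= i)%N -> p i = 0.
  by rewrite leqNgt -mP -leNgt => pi; apply/eqP; rewrite eq_le pi p_ge0.
have s0 (i : 'I_M) : (i < m)%N -> s i = 0.
  have ps_ge0 j : true -> 0 <= p j * s j.
    by have [_ _ _ sj] := bnd j; rewrite mulr_ge0.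
  rewrite -mP => pi; have /eqP := psumr_eq0P ps_ge0 c0 (isT : true) (i := i).
  by rewrite mulf_eq0 gt_eqF//= => /eqP.
have xlL (i : 'I_M) : (i < m)%N -> L <= x i * l i.
  by move=> im; have := loc i; rewrite mP im s0// !addr0; apply.
have x1 i : 1 <= x i by have [] := bnd i.
have x0 i : 0 < x i by exact: lt_le_trans (x1 i).
have l0 i : 0 <= l i by have [] := bnd i.
pose l1 := Num.min (C / m%:R) L.
have mR : 0 < m%:R :> R by rewrite ltr0n.
have l1_gt0 : 0 < l1 by rewrite lt_min L_gt0 divr_gt0.
have l1L : l1 <= L by rewrite ge_min lexx orbT.
have l1Cm : l1 <= C / m%:R by rewrite ge_min lexx.
have l1C : l1 <= C.
  by apply: le_trans l1Cm _; rewrite ler_pdivrMr// ler_peMr ?ler1n// ltW.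
set n := full_videos C l1.
have /andP[n1 n2] := full_videos_itv l1_gt0 C_gt0; rewrite -/n in n1 n2.
have mn : (m <= n)%N.
  rewrite -ltnS -(ltr_nat R) -(ltr_pM2r l1_gt0) -natr1 mulrDl mul1r.
  by apply: le_lt_trans n2; rewrite mulrC -ler_pdivlMr.
pose y (i : 'I_M) := if (i < n)%N then L / l1 else 1.
have ratio1 : 1 <= L / l1 by rewrite ler_pdivlMr// mul1r.
have y1 i : 1 <= y i by rewrite /y; case: ifP.
have cP := cache_allocation_itv l1_gt0 C_gt0.
have card_m : #|[pred i : 'I_M | (i < m)%N]| = m.
  by rewrite -sum1_card -(big_ord_widen _ (fun=> 1%N) mM) sum1_card card_ord.
have yE : \prod_i y i <= E.
  have [CmL|LCm] := leP (C / m%:R) L; last first.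
    have l1E : l1 = L by rewrite /l1 (min_idPr (ltW LCm)).
    rewrite big1 ?expR_ge0 => [|i _]; last by rewrite /y l1E divff ?gt_eqF//; case: ifP.
    by rewrite -expR0 ler_expR !mulr_ge0 ?invr_ge0// ltW.
  have l1E : l1 = C / m%:R by rewrite /l1 (min_idPl CmL).
  have nm : n = m.
    apply: (@full_videosP _ _ _ l1_gt0 _ 0); rewrite ?lexx//.
    by rewrite addr0 l1E mulrC divfK// gt_eqF.
  have -> : \prod_i y i = (L / l1) ^+ m.
    by rewrite /y nm -big_mkcond/= prodr_const card_m.
  rewrite expr_div_n ler_pdivrMr ?exprn_gt0//.
  (* The chain is [L ^+ m <= \prod (x i * l i) <= E * (C / m) ^+ m] over the first [m] videos. *)
  have agm := leif_AGM (A := [pred i : 'I_M | (i < m)%N]) (E := l) (fun i _ => l0 i).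
  rewrite card_m in agm.
  apply: (@le_trans _ _ (\prod_(i < M | (i < m)%N) (x i * l i))).
    rewrite -[in leLHS]card_m -prodr_const; apply: ler_prod => i im.
    by rewrite ltW//= xlL.
  rewrite big_split/=; apply: ler_pM.
  - by apply: prodr_ge0 => i _; exact: ltW.
  - by apply: prodr_ge0.
  - apply: le_trans xE; rewrite [leRHS](bigID (fun i : 'I_M => (i < m)%N))/=.
    rewrite ler_peMr//; first by apply: prodr_ge0 => i _; exact: ltW.
    by elim/big_ind: _ => // a b a1 b1; rewrite mulr_ege1.
  - apply: le_trans (agm.1) _; apply: lerXn2r; rewrite ?nnegrE.
    + by rewrite divr_ge0// sumr_ge0.
    + exact: ltW.
    rewrite l1E ler_pM2r ?invr_gt0//; apply: le_trans lC.
    by rewrite [leRHS](bigID (fun i : 'I_M => (i < m)%N))/= lerDl sumr_ge0.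
have ycL i : y i * cache_allocation C l1 i <= L.
  rewrite /y; case: ifP => [ni|_]; last first.
    by rewrite mul1r; apply: le_trans l1L; have /andP[] := cP M i.
  by rewrite /cache_allocation -/n ni divfK// gt_eqF.
have feas : feasible L r fB B C (fun i => r / fB * ln (y i)) (cache_allocation C l1).
  apply: feasible_ln => // [i|]; first by have /andP[] := cP M i.
  exact: cache_allocation_sum.
have up : (avg_waiting_time L r fB p (fun i => (r / fB * ln (y i))%R)
    (cache_allocation C l1) <= (cost p (fun=> 0%R) / r)%:E)%E.
  apply: avg_waiting_time_upper => // i; split => // pi; split => //.
  have ni : (i < n)%N by apply: leq_trans mn; rewrite -mP.
  by rewrite /y /cache_allocation -/n ni !addr0 divfK// gt_eqF.
have cost0 : cost p (fun=> 0) = 0 by rewrite /cost big1// => i; rewrite mulr0.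
exists l1, (fun i => r / fB * ln (y i)); split => //.
- rewrite /search_interval/=; apply/andP; split; last first.
    by rewrite [leRHS]minC le_min l1C.
  rewrite /l1 le_min; apply/andP; split.
    apply: (@le_trans _ _ (C / M%:R)).
      by rewrite ler_pM2r ?invr_gt0 ?ltr0n// ge_min lexx orbT.
    by rewrite ler_pM2l// lef_pV2 ?posrE ?ltr0n// ler_nat.
  rewrite ler_pdivrMr ?ltr0n//; apply: (@le_trans _ _ L).
    by rewrite ge_min lexx.
  by rewrite ler_peMr ?ler1n// ltW.
(* With [beta = 0] the multiplier formula gives bandwidth 0. The videos from [n] on are unpopular,
   as [m <= n], so the bandwidth need not be exhausted. *)
- exists n, 0; split => //.
  + by left.
  + apply/funext => i; rewrite /bandwidth_allocation /y; case: ifP => // _.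
    rewrite /multiplier_bandwidth mulr0 mul0r /= expr0n /= mulr0 !addr0 sqrtr0.
    by rewrite addr0 divff ?pnatr_eq0.
  + case=> i ni; rewrite pm ?mul0r ?ltxx//; exact: leq_trans ni.
- split => // b' l' feas'; apply: le_trans up _.
  apply: (avg_waiting_time_lower L_gt0 r_gt0 fB_gt0 p_ge0 _ feas') => x2 l2 s2 f2.
  by rewrite cost0 -c0; exact: o.2 f2.
- by apply: le_lt_trans up _; rewrite ltry.
Qed.

Lemma structured_optimum_exists : exists l1 b, structured_optimum l1 b.
Proof.
have E1 : 1 < E by rewrite expR_gt1 mulr_gt0// divr_gt0.
have [x [l [s [ o sS]]]] := relaxed_optimal_sorted L_gt0 E1 C_gt0 p_ge0 p_sum1 p_noninc.
have : 0 <= cost p s.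
  by apply: cost_ge0 => // i; have [_ _ b _] := o.1; have [] := b i.
rewrite le_eqVlt => /orP[/eqP c0|c0].
  exact: structured_optimum_zero o (esym c0).
exact: structured_optimum_positive o c0 sS.
Qed.

End Existence.

(** * Attainment of the infimum that defines [phi] *)

Section Attainment.
Variables (R : realType) (M : nat) (L r fB B C : R) (p : 'I_M -> R).
Hypotheses (L_gt0 : 0 < L) (r_gt0 : 0 < r) (fB_gt0 : 0 < fB).
Hypothesis p_ge0 : forall i, 0 <= p i.

Lemma multiplier_bandwidth_nondecreasing beta beta' q li : 0 <= q -> li <= L ->
  0 <= beta -> beta <= beta' ->
  multiplier_bandwidth L r fB beta q li <= multiplier_bandwidth L r fB beta' q li.
Proof.
move=> q0 liL b0 bb'; rewrite /multiplier_bandwidth.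
set c := q * beta * _; set c' := q * beta' * _.
have c0 : 0 <= c by rewrite !mulr_ge0// subr_ge0.
have cc' : c <= c' by rewrite ler_wpM2r ?subr_ge0// ler_wpM2l.
have c'0 : 0 <= c' by exact: le_trans cc'.
have rf : 0 <= r / fB by rewrite divr_ge0// ltW.
apply: ler_wpM2l => //.
have pos y : 0 <= y -> 0 < (2 + y + Num.sqrt (y ^+ 2 + 4 * y)) / 2.
  move=> y0; rewrite divr_gt0// ltr_pwDl ?sqrtr_ge0//.
  by rewrite ltr_pwDl.
rewrite ler_ln ?posrE ?pos//.
rewrite ler_pM2r ?invr_gt0// lerD ?lerD2l// ler_wsqrtr// lerD//.
  by rewrite lerXn2r.
by rewrite ler_pM2l.
Qed.

Definition induced_with (n : nat) (l1 : R) (b : 'I_M -> R) (beta : R) : Prop :=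
  [/\ 0 <= beta, b = bandwidth_allocation n L r fB C p l1 beta,
      ((exists2 i : 'I_M, (n <= i)%N & 0 < p i * (L - cache_allocation C l1 i)) ->
        \sum_(i < M) b i = B) &
      feasible L r fB B C b (cache_allocation C l1)].

(** Each bandwidth is nondecreasing in [beta], so two allocations with the same sum [B] coincide. If
    the sum is not prescribed, no bandwidth depends on [beta]. *)
Lemma induced_with_unique n l1 b b' beta beta' :
  induced_with n l1 b beta -> induced_with n l1 b' beta' -> b = b'.
Proof.
wlog bb' : b b' beta beta' / beta <= beta'.
  move=> h i1 i2; have [bb'|/ltW bb'] := leP beta beta'; first exact: h i1 i2.
  by apply/esym; exact: h i2 i1.
move=> [b0 bE sumb [_ _ bb0 bl]] [b'0 b'E sumb' _].
have lL (i : 'I_M) : cache_allocation C l1 i <= L.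
  have /andP[_ h] := bl i; apply: le_trans h _.
  rewrite ger_pMr// -expR0 ler_expR oppr_le0.
  by rewrite mulr_ge0// divr_ge0// ltW.
have bb i : b i <= b' i.
  rewrite bE b'E /bandwidth_allocation; case: ifP => // _.
  exact: multiplier_bandwidth_nondecreasing.
have [h|h] := pselect
    (exists2 i : 'I_M, (n <= i)%N & 0 < p i * (L - cache_allocation C l1 i)).
  have d0 : \sum_i (b' i - b i) = 0 by rewrite sumrB sumb'// sumb// subrr.
  have dge i : true -> 0 <= b' i - b i by rewrite subr_ge0.
  apply/funext => i; apply/esym/eqP; rewrite -subr_eq0; apply/eqP.
  exact: (psumr_eq0P dge d0).
rewrite bE b'E; apply/funext => i; rewrite /bandwidth_allocation.
case: ltnP => // ni; rewrite /multiplier_bandwidth.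
have c0 : p i * (L - cache_allocation C l1 i) = 0.
  apply/eqP; rewrite eq_le mulr_ge0 ?subr_ge0// andbT leNgt; apply/negP => c0.
  by apply: h; exists i.
have cE t : p i * t * (L - cache_allocation C l1 i) = 0.
  by rewrite mulrAC c0 mul0r.
by rewrite !cE.
Qed.

(** At most two values of [n] are possible, hence at most two induced allocations, whereas an
    unattained infimum would provide three with strictly decreasing values. *)
Lemma phi_attained l1 : (phi L r fB B C p l1 < +oo)%E ->
  exists2 b, induced_bandwidth L r fB B C p l1 b &
    avg_waiting_time L r fB p b (cache_allocation C l1) = phi L r fB B C p l1.
Proof.
move=> phiy; apply: contrapT => natt.
pose W b := avg_waiting_time L r fB p b (cache_allocation C l1).
have W_ge b : induced_bandwidth L r fB B C p l1 b -> (phi L r fB B C p l1 <= W b)%E.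
  by move=> ib; apply: ereal_inf_lbound; exists b.
have lower v : (phi L r fB B C p l1 < v)%E -> exists b,
    [/\ induced_bandwidth L r fB B C p l1 b, (W b < v)%E &
        (phi L r fB B C p l1 < W b)%E].
  move=> /ereal_inf_ltP[_ [b ib <-] Wv]; exists b; split => //.
  rewrite lt_neqAle W_ge// andbT; apply/eqP => e; apply: natt.
  by exists b.
have [b0 [i0 _ /lower[b1 [i1 W10 /lower[b2 [i2 W21 _]]]]]] := lower _ phiy.
case: i0 i1 i2 => [n0 [beta0 [s0 ? ? ? ?]]] [n1 [beta1 [s1 ? ? ? ?]]]
  [n2 [beta2 [s2 ? ? ? ?]]].
have n_val n : saturated_number L C l1 n -> n = full_videos C l1 \/ n = 0%N.
  by case=> [[_ ->]|[_ [_ ->]]]; [left|right].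
have ind0 : induced_with n0 l1 b0 beta0 by split.
have ind1 : induced_with n1 l1 b1 beta1 by split.
have ind2 : induced_with n2 l1 b2 beta2 by split.
have [e|[e|e]] : n0 = n1 \/ n1 = n2 \/ n0 = n2.
  by case: (n_val _ s0) (n_val _ s1) (n_val _ s2) => -> [] -> [] ->; tauto.
- rewrite e in ind0; move: W10.
  by rewrite (induced_with_unique ind0 ind1) ltxx.
- rewrite e in ind1; move: W21.
  by rewrite (induced_with_unique ind1 ind2) ltxx.
- rewrite e in ind0; move: (lt_trans W21 W10).
  by rewrite (induced_with_unique ind0 ind2) ltxx.
Qed.

End Attainment.

Theorem lemma5 (R : realType) (M : nat) (L r fB B C : R) (p : 'I_M -> R)
  (L_gt0 : 0 < L) (r_gt0 : 0 < r) (fB_gt0 : 0 < fB) (B_gt0 : 0 < B)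
  (C_gt0 : 0 < C) (C_lt : C < M%:R * L)
  (p_ge0 : forall i, 0 <= p i)
  (p_noninc : forall i j : 'I_M, (i <= j)%N -> p j <= p i)
  (p_sum1 : \sum_(i < M) p i = 1) :
  (exists l1, minimizers (search_interval M L C) (phi L r fB B C p) l1) /\
  (forall l1, minimizers (search_interval M L C) (phi L r fB B C p) l1 ->
    (exists2 b : 'I_M -> R, induced_bandwidth L r fB B C p l1 b &
      avg_waiting_time L r fB p b (cache_allocation C l1) =
        phi L r fB B C p l1) /\
    (forall b : 'I_M -> R, induced_bandwidth L r fB B C p l1 b ->
      avg_waiting_time L r fB p b (cache_allocation C l1) =
        phi L r fB B C p l1 ->
      optimal_allocation L r fB B C p b (cache_allocation C l1))).
Proof.
have [l0 [b0 [l0I ind0 [feas0 opt0] fin0]]] := structured_optimum_exists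
  L_gt0 r_gt0 fB_gt0 B_gt0 C_gt0 p_ge0 p_noninc p_sum1.
set V := avg_waiting_time L r fB p b0 (cache_allocation C l0) in opt0 fin0.
(* Every induced allocation is feasible for the full problem, so [phi] never falls below its optimum
   [V]; at [l0] it equals [V]. *)
have V_le l1 : (V <= phi L r fB B C p l1)%E.
  apply: le_ereal_inf_tmp => _ [b [n [beta [_ _ _ _ feas]]] <-].
  exact: opt0.
have phi0 : phi L r fB B C p l0 = V.
  apply/eqP; rewrite eq_le V_le andbT; apply: ereal_inf_lbound.
  by exists b0.
split; first by exists l0; split => // l1 _; rewrite phi0.
move=> l1 [_ /(_ _ l0I)]; rewrite phi0 => phi1.
split.
  by apply: phi_attained => //; exact: le_lt_trans fin0.
move=> b [n [beta [_ _ _ _ feas]]] bphi; split => // b' l' feas'.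
by rewrite bphi; apply: le_trans phi1 _; exact: opt0.
Qed.
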